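(* Let $r,m$ be positive integers with $m\ne 2$, let $(k_i,m_i)$, $1\le i\le r$, be pairs of positive integers with $m_i\ge 2$, and if $m=1$ assume $k_1\ge 2$. Let $G=G^{m}_{(k_1,m_1)\cdots(k_r,m_r)}$ be the level-wise regular block graph. Then $G$ is a lower bound block graph and $$rn(G)=\left[(m-1)+m\sum_{i=1}^{r}\left(\prod_{1\le j\le i}k_jm_j\right)\right](2r+1)-2m\sum_{i=1}^{r} i\left(\prod_{1\le j\le i}k_jm_j\right)+\varepsilon(G).$$
   Context: Graphs are finite and simple. For a connected graph $G$, $d(u,v)$ is the distance and $d(G)$ the diameter. A radio labeling of $G$ is a map $f:V(G)\to\{0,1,2,\ldots\}$ with $|f(u)-f(v)|\ge d(G)+1-d(u,v)$ for all distinct $u,v$. Its span is $\max\{|f(u)-f(v)|:u,v\in V(G)\}$, and $rn(G)$ is the minimum span of a radio labeling of $G$. A block is a maximal connected induced subgraph without cut-vertices (of itself). A block graph is a connected graph all of whose blocks are complete graphs. The weight at $v$ is $wt(v)=\sum_{u\in V(G)}d(u,v)$, and $W(G)$ is the set of vertices of minimum weight (weight centers). If $|W(G)|\ge2$, then $W(G)$ is contained in a (unique) block, called the central block. The central vertices of $G$ are: the unique weight center if $|W(G)|=1$; all vertices of the central block if $|W(G)|\ge 2$. The level of $v$ is $L(v)=\min\{d(v,w): w \text{ a central vertex}\}$ and $L(G)=\sum_{v\in V(G)}L(v)$. Set $\varepsilon(G)=1$ if $|W(G)|=1$ and $\varepsilon(G)=0$ if $|W(G)|\ge2$. For a block graph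 $G$ of order $p$ put $LB(G)=(p-1)(d(G)+\varepsilon(G))-2L(G)+\varepsilon(G)$; $G$ is called a lower bound block graph if $rn(G)=LB(G)$. The level-wise regular block graph $G^{m}_{(k_1,m_1)(k_2,m_2)\cdots(k_r,m_r)}$ is constructed as follows. An end vertex is a non-cut-vertex. For $i=0$, take a clique $K_m$ with vertex set $\{w^0,w^1,\ldots,w^{m-1}\}$; for $i=1$, to each of $w^0,\ldots,w^{m-1}$ identify one vertex of each of $k_1$ copies of $K_{m_1+1}$. Inductively, at the $i$-th step, $2\le i\le r$, to each end vertex of the cliques joined in the $(i-1)$-th step identify one vertex of each of $k_i$ copies of the clique $K_{m_i+1}$. (One has $W(G)=\{w^0,\ldots,w^{m-1}\}$.) *)

(* Defs.v *)
From HB Require Import structures.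
From mathcomp Require Import all_boot all_order all_algebra.
From mathcomp Require Import boolp.

Set Implicit Arguments.
Unset Strict Implicit.
Unset Printing Implicit Defensive.

Import GRing.Theory Num.Theory.

Record sgraph := SGraph {
  vertex :> finType;
  edge : rel vertex;
  edge_sym : symmetric edge;
  edge_irr : irreflexive edge
}.

Section Graphs.
Variable G : sgraph.
Implicit Types (u v w x : G) (A B : {set G}) (f : G -> nat).

(** ** Distance and diameter *)

(* The least length of a walk from [u] to [v]; it is [#|G|] when there is none,
   since a shortest walk has fewer than [#|G|] edges. *)
Definition dist u v : nat :=
  find (fun n => [exists p : n.-tuple G, path (@edge G) u p && (last u p == v)])
       (iota 0 #|G|).

Definition diam : nat := \max_u \max_v dist u v.

(** ** Radio labelings *)

(* The subtraction on the left is truncated, which is harmless because the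
   right-hand side is nonnegative. *)
Definition radio_labeling f : Prop :=
  forall u v, u != v -> (diam.+1 - dist u v <= `|f u - f v|)%N.

Definition span f : nat := \max_u \max_v `|f u - f v|%N.

Fact radio_span_ex :
  exists n, `[< exists2 f, radio_labeling f & span f = n >].
Proof.
pose f u := (diam.+1 * enum_rank u)%N.
exists (span f); apply/asboolP; exists f => // u v neq_uv.
apply: leq_trans (leq_subr _ _) _.
have : enum_rank u != enum_rank v by rewrite (inj_eq enum_rank_inj).
rewrite /f -val_eqE /=; move: (nat_of_ord _) (nat_of_ord _) => a b neq_ab.
rewrite !PoszM -mulrBr abszM absz_nat leq_pmulr // absz_gt0 subr_eq0.
by rewrite eqz_nat.
Qed.

Definition rn : nat := ex_minn radio_span_ex.

(** ** Blocks *)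

Definition linked A u v : bool :=
  connect [rel x y | [&& edge x y, x \in A & y \in A]] u v.

Definition connected_in A : bool :=
  (A != set0) && [forall u in A, forall v in A, linked A u v].

(* [x] is a cut-vertex of the subgraph induced by [A]. *)
Definition cut_vertex A x : bool :=
  (x \in A) &&
  [exists u in A :\ x, exists v in A :\ x,
     linked A u v && ~~ linked (A :\ x) u v].

Definition block B : bool :=
  maxset (fun A => connected_in A && [forall x, ~~ cut_vertex A x]) B.

Definition clique A : bool :=
  [forall u in A, forall v in A, (u != v) ==> edge u v].

Definition block_graph : bool :=
  connected_in setT && [forall B : {set G}, block B ==> clique B].

Definition end_vertex x : bool := ~~ cut_vertex setT x.

(** ** Weight centers and levels *)

Definition wt v : nat := \sum_u dist u v.

Definition weight_centers : {set G} := [set v | [forall u, wt v <= wt u]].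

(* In a connected graph the block is unique when there are at least two weight
   centers, the only case in which this definition is used. *)
Definition central_block : {set G} :=
  odflt set0 [pick B : {set G} | block B && (weight_centers \subset B)].

Definition central_vertices : {set G} :=
  if #|weight_centers| == 1 then weight_centers else central_block.

(* The default value [#|G|] exceeds every distance of a connected graph. *)
Definition level v : nat :=
  \big[minn/#|G|]_(w in central_vertices) dist v w.

Definition total_level : nat := \sum_v level v.

Definition eps : nat := #|weight_centers| == 1.

Definition LB : int :=
  ((#|G|%:Z - 1) * (diam%:Z + eps%:Z) - 2 * total_level%:Z + eps%:Z)%R.

Definition lower_bound_block_graph : Prop :=
  block_graph /\ (rn%:Z = LB)%R.

End Graphs.

(** ** Level-wise regular block graphs *)

Section Complete.
Variable m : nat.

Definition complete_edge : rel 'I_m := fun i j => i != j.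

Fact complete_edge_sym : symmetric complete_edge.
Proof. by move=> i j; rewrite /complete_edge eq_sym. Qed.

Fact complete_edge_irr : irreflexive complete_edge.
Proof. by move=> i; rewrite /complete_edge eqxx. Qed.

Definition complete_graph : sgraph :=
  SGraph complete_edge_sym complete_edge_irr.

End Complete.

(* To each vertex [s] of [U], [k] copies of the clique on [n.+1] vertices are
   joined by identifying one vertex of the copy with [s]; the triple [(s, c, i)]
   is the [i]-th of the [n] remaining vertices of the [c]-th copy at [s]. *)
Section Join.
Variables (G : sgraph) (U : {set G}) (k n : nat).

Definition join_vertex : finType :=
  (G + ({s : G | s \in U} * 'I_k * 'I_n))%type.

Definition join_edge : rel join_vertex := fun a b =>
  match a, b with
  | inl x, inl y => edge x y
  | inl x, inr (s, _, _) => x == val s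
  | inr (s, _, _), inl y => y == val s
  | inr (sc, i), inr (tc, j) => (sc == tc) && (i != j)
  end.

Fact join_edge_sym : symmetric join_edge.
Proof.
case=> [x|[[s c] i]] [y|[[t d] j]] //=; first exact: edge_sym.
by rewrite eq_sym (eq_sym i).
Qed.

Fact join_edge_irr : irreflexive join_edge.
Proof. by case=> [x|[[s c] i]] /=; rewrite ?edge_irr ?eqxx. Qed.

Definition join_cliques : sgraph := SGraph join_edge_sym join_edge_irr.

(* The end vertices of the extended graph that lie in the joined cliques. *)
Definition joined_end_vertices : {set join_cliques} :=
  [set z : join_cliques |
     (if z is inl x then x \in U else true) && end_vertex z].

End Join.

(* The graph obtained after [r] steps, together with the set of vertices at
   which the next step joins its cliques. *)
Fixpoint lwr_steps (m : nat) (k n : nat -> nat) (r : nat) :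
    {G : sgraph & {set G}} :=
  if r is r'.+1 then
    let: existT G U := lwr_steps m k n r' in
    existT _ (join_cliques U (k r) (n r)) (joined_end_vertices U (k r) (n r))
  else existT _ (complete_graph m) setT.

(* Only the values of [k] and [n] at [1], ..., [r] are used. *)
Definition level_wise_regular (m : nat) (k n : nat -> nat) (r : nat) : sgraph :=
  projT1 (lwr_steps m k n r).

(* Main.v *)
Require Import Defs.
From HB Require Import structures.
From mathcomp Require Import all_boot all_order all_algebra.
From mathcomp Require Import boolp zify.

Set Implicit Arguments.
Unset Strict Implicit.
Unset Printing Implicit Defensive.

(** Every vertex gets an address, the list of steps that lead to it from the
    central clique: the head [(0, t)] names a vertex of that clique, and each
    further entry [(c, i)] the [i]-th new vertex of the [c]-th clique joined to
    the vertex reached so far.  The level of a vertex is the length of its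
    address minus one, and [adist] reads the distance of two vertices off their
    addresses: below their longest common prefix the paths run disjointly, with
    one edge saved when they leave it inside the same clique.  Everything that
    is asked about the graph (blocks, cut-vertices, weights, distances) becomes
    a question on lists; [lwr_addressed] builds the addresses along the
    construction and [dist_addr] identifies [dist] with [adist].

    Two vertices at distance at least 2 are separated by a vertex of a geodesic
    ([adist_gt1_separable]), so a connected set without cut-vertices is a
    clique and the graph is a block graph.  Outside the central clique weights
    are larger: an exchange of two central vertices, or of two cliques at the
    unique central vertex, moves a branch off itself, and on average over each
    orbit of this exchange a vertex of the branch is farther away than its
    central ancestor ([wt_lt]).  So the central vertices are exactly those of
    the initial clique.

    Since [dist u v] is at most the sum of the levels plus [1 - eps], listing
    the vertices by increasing label and adding up the gaps gives [rn >= LB]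
    ([rn_lower_bound]).  Equality needs an ordering whose consecutive vertices
    all lie in different branches and whose two ends have levels adding up to
    [eps].  Such a list forces the labels
    ([rn_upper_bound]), and the radio condition for the positions [i < j]
    follows from [|a| + |b| <= eps + adist a b + (j - i)], where [a] and [b] are
    the addresses and [|a|], [|b|] their lengths ([digits_far]).

    The vertex at position [i] is given the address made of the digits of
    [i.+1] in the mixed radix with bases [m, k_1 n_1, k_2 n_2, ...], the least
    significant digit being the central vertex.  If two addresses share a
    prefix of length [q], then [j - i] is a multiple of the product of the
    first [q] bases, which grows exponentially in [q], whereas the distance
    only drops linearly.  The hypotheses [m != 2], and [k_1 >= 2] for [m = 1],
    are what makes the smallest values of [q] work. *)

(** * Addresses and their distance *)

Section Addresses.

Definition address := seq (nat * nat).
Implicit Types (a b x : address).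

(** The entry at which two addresses diverge costs one edge instead of two when
    it leads into the same clique, that is, when its first components agree. *)
Fixpoint adist a b : nat :=
  match a, b with
  | e :: a', g :: b' =>
      if e == g then adist a' b' else size a' + size b' + (e.1 != g.1).+1
  | _, _ => size a + size b
  end.

Lemma adists0 a : adist a [::] = size a.
Proof. by case: a => //= *; rewrite addn0. Qed.

Lemma adistaa a : adist a a = 0.
Proof. by elim: a => //= e a ->; rewrite eqxx. Qed.

Lemma adistC : commutative adist.
Proof.
elim=> [|e a IHa] [|g b] //=; rewrite ?addn0 //.
by rewrite (addnC (size a)) IHa (eq_sym g) (eq_sym g.1).
Qed.

Lemma adist_eq0 a b : (adist a b == 0) = (a == b).
Proof.
elim: a b => [|e a IHa] [|g b] //=; rewrite eqseq_cons.
by case: (e == g) => /=; [exact: IHa | rewrite addnS].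
Qed.

Lemma adist_leD a b : adist a b <= size a + size b.
Proof.
elim: a b => [|e a IHa] [|g b] //=; rewrite ?addn0 //.
by case: eqP => _; [have := IHa b | ]; lia.
Qed.

Lemma leq_size_adist a b : size a <= size b + adist a b.
Proof.
elim: a b => [|e a IHa] [|g b] //=; rewrite ?addn0 //.
by case: eqP => _; [have := IHa b | ]; lia.
Qed.

Lemma adist_triangle b a c : adist a c <= adist a b + adist b c.
Proof.
elim: b a c => [|g b IHb] a c.
  by rewrite adists0; exact: adist_leD.
case: a c => [|e a] [|l c] //.
- by rewrite (adistC (g :: b)); exact: (leq_size_adist (l :: c)).
- by rewrite !adists0 addnC; exact: leq_size_adist.
have IH := IHb a c; have la := leq_size_adist a b.
have lc := leq_size_adist c b; rewrite (adistC c) in lc.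
rewrite /=; case: (eqVneq e g) => [->|].
  by case: eqP; lia.
case: (eqVneq g l) => [->|]; first by move=> /negbTE->; lia.
case: (eqVneq e l) => [<-|]; first by have := adist_leD a c; lia.
by case: (eqVneq e.1 g.1) => [->|]; case: (eqVneq g.1 l.1) => /=; lia.
Qed.

(** The neighbour of [a] on the geodesic to [b]: one entry further towards [b]
    if [a] is a prefix of [b], the sibling of [a] below which [b] lies if they
    part inside one clique, and the parent of [a] otherwise. *)
Fixpoint astep a b : address :=
  match a, b with
  | [::], g :: _ => [:: g]
  | e :: a', g :: b' =>
      if e == g then e :: astep a' b'
      else if a' is e' :: a'' then e :: belast e' a''
      else if e.1 == g.1 then [:: g] else [::]
  | e :: a', [::] => belast e a'
  | _, _ => [::]
  end.

Lemma adist_rcons a e : adist (rcons a e) a = 1.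
Proof. by elim: a => //= g a IHa; rewrite eqxx. Qed.

Lemma adist_belast e a : adist (e :: a) (belast e a) = 1.
Proof. by rewrite lastI adist_rcons. Qed.

Lemma astep_edge a b : a != b -> adist a (astep a b) = 1.
Proof.
elim: a b => [|e a IHa] [|g b] //; first by rewrite adist_belast.
rewrite eqseq_cons /=; case: (eqVneq e g) => /= [_ /IHa|neq _].
  by rewrite eqxx.
case: a {IHa} => [|e' a]; last exact: (adist_belast e (e' :: a)).
by case: ifP => //= ->; rewrite (negbTE neq).
Qed.

Lemma astep_adist a b : a != b -> adist a b = (adist (astep a b) b).+1.
Proof.
elim: a b => [|e a IHa] [|g b] //; first by rewrite /= eqxx.
  by rewrite !adists0 size_belast.
rewrite eqseq_cons /=; case: (eqVneq e g) => /= [-> /IHa|neq _].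
  by rewrite eqxx.
case: a {IHa} => [|e' a] /=; last by rewrite (negbTE neq) /= size_belast; lia.
by case: (eqVneq e.1) => //= _; rewrite ?eqxx //; lia.
Qed.

Lemma astep_prefix a b : prefix (astep a b) a || prefix (astep a b) b.
Proof.
elim: a b => [|e a IHa] [|g b] //; first by rewrite /= eqxx prefix0s.
  by rewrite [astep _ _]/= lastI prefix_rcons.
rewrite [astep _ _]/=; case: (eqVneq e g) => [<-|_].
  by rewrite !prefix_cons eqxx; exact: IHa.
case: a {IHa} => [|e' a].
  by case: ifP => _ //; rewrite !prefix_cons !eqxx !prefix0s orbT.
by rewrite (lastI e') prefix_cons eqxx prefix_rcons.
Qed.

(** The vertices that the removal of [x] leaves in one component with the
    [c]-th clique joined to [x]. *)
Fixpoint branch x (c : nat) a : bool :=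
  match x, a with
  | _, [::] => false
  | [::], g :: _ => g.1 == c
  | e :: x', g :: a' => (e == g) && branch x' c a'
  end.

Lemma branch_rcons x g : branch x g.1 (rcons x g).
Proof. by elim: x => [|e x IHx] /=; rewrite eqxx. Qed.

Lemma branch_size x c a : branch x c a -> size x < size a.
Proof. by elim: x a => [|e x IHx] [|g a] //= /andP[_]; apply: IHx. Qed.

(** A branch can only be left through the vertex at which it is attached. *)
Lemma branch_sep x c a b :
  branch x c a -> ~~ branch x c b -> adist a b <= 1 -> b = x.
Proof.
elim: x a b => [|e x IHx] [|g a] [|l b] //=.
- move=> /eqP<-; case: (eqVneq g l) => [<-|_]; rewrite ?eqxx //.
  by rewrite (eq_sym l.1) => ->; lia.
- by case/andP=> _ /branch_size; lia.
case/andP=> /eqP<- ba; case: (eqVneq e l) => [<- /= nb le1|_ _].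
  by rewrite (IHx _ _ ba nb le1).
by have := branch_size ba; lia.
Qed.

(** Hence a geodesic that leaves a branch runs through that vertex. *)
Lemma adist_branch x c a b :
  branch x c a -> ~~ branch x c b -> adist a b = adist a x + adist x b.
Proof.
elim: x a b => [|e x IHx] [|g a] [|l b] //=; try lia.
- move=> /eqP<-; case: (eqVneq g l) => [<-|_]; rewrite ?eqxx //.
  by rewrite (eq_sym l.1) => ->; lia.
- case/andP=> /eqP-> ba _; rewrite eqxx.
  by have := IHx _ [::] ba; rewrite !adists0; case: (x) => /= [|*]; lia.
case/andP=> /eqP-> ba; rewrite eqxx; case: (eqVneq g l) => [_|_ _] /=.
  exact: IHx.
by have := IHx _ [::] ba; rewrite !adists0; case: (x) => /= [|*]; lia.
Qed.

Definition separates x c a b := [&& branch x c a, ~~ branch x c b & x != b].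

Definition separable a b := exists x c,
  (prefix x a || prefix x b) /\ (separates x c a b || separates x c b a).

Lemma separableC a b : separable a b -> separable b a.
Proof. by case=> x [c [p s]]; exists x, c; rewrite orbC p orbC s. Qed.

Lemma separable_cons e a b : separable a b -> separable (e :: a) (e :: b).
Proof.
case=> x [c [p s]]; exists (e :: x), c.
by rewrite /separates /= !eqxx /= !eqseq_cons eqxx.
Qed.

Lemma separable_head e a g b :
  e != g -> a != [::] -> exists x c,
  prefix (e :: x) (e :: a) /\ separates (e :: x) c (e :: a) (g :: b).
Proof.
case/lastP: a => // a l neq _; exists a, l.1.
rewrite /separates eqseq_cons /= eqxx (negbTE neq) /= branch_rcons.
by rewrite prefix_rcons.
Qed.

(** If one of the addresses has at least two entries after the fork, its parent
    separates them; if each has just one and these lie in different cliques,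
    the common prefix does. *)
Lemma adist_gt1_separable a b : 1 < adist a b -> separable a b.
Proof.
have nil e a' : a' != [::] -> separable [::] (e :: a').
  case/lastP: a' => // a' l _; exists (e :: a'), l.1.
  by rewrite prefix_cons eqxx prefix_rcons orbT /separates /= eqxx branch_rcons.
elim: a b => [|e a IHa] [|g b] //=.
- by case: b nil => // l b nil _; apply: nil.
- by case: a {IHa} nil => // l b nil _; apply/separableC/nil.
case: (eqVneq e g) => [<- /IHa/separable_cons|neq] //.
case: (eqVneq e.1 g.1) => [_ lt1|neq1 _]; last first.
  by exists [::], e.1; rewrite /separates /= eqxx eq_sym neq1.
have [a0|na] := eqVneq a [::]; last first.
  have [x [c [p s]]] := separable_head b neq na.
  by exists (e :: x), c; rewrite p s.
have nb : b != [::] by case: b lt1 => //; rewrite a0.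
have [x [c [p s]]] := separable_head a (contra_neq esym neq) nb.
by exists (g :: x), c; rewrite p s !orbT.
Qed.

(** The empty list is no vertex, so it must not be the separator; it is one only
    for addresses whose heads lie in different cliques. *)
Lemma separable_top e a g b : e.1 = g.1 -> 1 < adist (e :: a) (g :: b) ->
  exists x c, [/\ prefix x (e :: a) || prefix x (g :: b), x != [::] &
    separates x c (e :: a) (g :: b) || separates x c (g :: b) (e :: a)].
Proof.
move=> e1 lt1; have [x [c [p s]]] := adist_gt1_separable lt1.
exists x, c; split=> //; case: x {p} s => //=.
by rewrite /separates /= -e1; case: eqP.
Qed.

End Addresses.

(** * Distances, cuts and radio labelings in an arbitrary graph *)

Section Generic.

Variable G : sgraph.
Implicit Types (u v w x : G) (A B C : {set G}) (f : G -> nat).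

(** A function that vanishes on the diagonal, drops by at most one along edges
    and can always be made to drop by one is the distance.  A walk of length
    [t u v] is shortest, hence has no repeated vertex, which keeps its length
    within the range searched by [dist]. *)
Lemma dist_eq (t : G -> G -> nat) :
  (forall u, t u u = 0) ->
  (forall u v w, edge u v -> t u w <= (t v w).+1) ->
  (forall u v, u != v -> exists2 w, edge u w & t u v = (t w v).+1) ->
  forall u v, dist u v = t u v.
Proof.
move=> t0 t_lip t_step u v.
have t_path p : forall u, path (@edge G) u p -> t u (last u p) <= size p.
  elim: p => [|w p IHp] x /=; first by rewrite t0.
  case/andP=> /t_lip-/(_ (last w p)) le1 /IHp le2.
  exact: leq_trans le1 _.
have t_walk d : forall x, t x v = d ->
    exists p, [/\ path (@edge G) x p, last x p = v & size p = d].
  elim: d => [|d IHd] x tx.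
    exists [::]; split=> //=; apply/eqP; apply: contraT => /t_step[w _].
    by rewrite tx.
  have xv : x != v by apply: contra_eqN tx => /eqP->; rewrite t0.
  have [w xw] := t_step _ _ xv; rewrite tx => -[/esym/IHd[p [pP pl ps]]].
  by exists (w :: p); split=> //=; rewrite ?xw ?ps.
have [p [pP plast psize]] := t_walk _ u erefl.
have lt_card : t u v < #|G|.
  have {psize} := t_path; rewrite -plast => tp.
  case/shortenP: pP plast => q qP uq _ _; apply: leq_ltn_trans (tp _ _ qP) _.
  by rewrite -[(size q).+1]/(size (u :: q)) -(card_uniqP uq) max_card.
have Pt : [exists q : (t u v).-tuple G, path (@edge G) u q && (last u q == v)].
  apply/existsP; exists (tcast psize (in_tuple p)).
  by rewrite val_tcast /= pP plast eqxx.
rewrite /dist; set a := (fun _ => _) in |- *.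
have has_a : has a (iota 0 #|G|).
  by apply/hasP; exists (t u v); rewrite ?mem_iota.
apply/eqP; rewrite eqn_leq; apply/andP; split.
  rewrite leqNgt; apply/negP => /(before_find 0).
  by rewrite nth_iota // add0n /a Pt.
have := nth_find 0 has_a; rewrite nth_iota; last first.
  by rewrite has_find size_iota in has_a.
by rewrite add0n => /existsP[q /andP[/t_path + /eqP <-]]; rewrite size_tuple.
Qed.

Lemma dist_sym u v : dist u v = dist v u.
Proof.
pose walk d x y :=
  [exists p : d.-tuple G, path (@edge G) x p && (last x p == y)].
have sub d x y : walk d x y -> walk d y x.
  case/existsP=> p /andP[pP /eqP <-]; apply/existsP.
  have sz : size (rev (belast x p)) == d.
    by rewrite size_rev size_belast size_tuple.
  exists (Tuple sz) => /=; rewrite rev_path.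
  have -> : path (fun z => (@edge G)^~ z) x p.
    by under eq_path do rewrite edge_sym.
  by case: (tval p) => //= z q; rewrite rev_cons last_rcons.
by apply: eq_find => d; apply/idP/idP; apply: sub.
Qed.

Lemma linked_trans A : transitive (linked A).
Proof. exact: connect_trans. Qed.

Lemma linked_sym A : symmetric (linked A).
Proof.
apply: sym_connect_sym => u v /=.
by rewrite edge_sym [(u \in A) && _]andbC.
Qed.

Lemma linked_edge A u v : u \in A -> v \in A -> edge u v -> linked A u v.
Proof. by move=> uA vA uv; apply: connect1; rewrite /= uv uA vA. Qed.

Lemma linked_closed A (C : pred G) u v :
  (forall y z, C y -> edge y z -> z \in A -> C z) -> C u -> linked A u v -> C v.
Proof.
move=> clC Cu /connectP[p + ->]; elim: p u Cu => //= w p IHp u Cu /andP[+ pP].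
by case/and3P=> uw _ wA; apply: IHp pP; apply: clC uw wA.
Qed.

(** If no edge leaves [C] except through [x], then a set that links a vertex of
    [C] to one outside must contain [x], and loses the link with it. *)
Lemma separated_cut A (C : pred G) u v x :
  (forall y z, C y -> edge y z -> z != x -> C z) ->
  u \in A -> v \in A -> C u -> ~~ C v -> u != x -> v != x ->
  linked A u v -> cut_vertex A x.
Proof.
move=> clC uA vA Cu NCv ux vx luv.
have Nl (B : {set G}) : x \notin B -> ~~ linked B u v.
  move=> xB; apply: contraNN NCv; apply: linked_closed Cu => y z Cy yz zB.
  by apply: clC yz _ => //; apply: contraNneq xB => <-.
rewrite /cut_vertex; apply/andP; split.
  by apply: contraLR luv; exact: Nl.
apply/existsP; exists u; rewrite !inE ux uA; apply/existsP; exists v.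
by rewrite !inE vx vA luv Nl // !inE eqxx.
Qed.

Lemma clique_connected A : A != set0 -> clique A -> connected_in A.
Proof.
move=> A0 /forall_inP cA; rewrite /connected_in A0.
apply/forall_inP => u uA; apply/forall_inP => v vA.
have /forall_inP/(_ v vA)/implyP uv := cA u uA.
by have [->|/uv] := eqVneq u v; [apply: connect0 | apply: linked_edge].
Qed.

Lemma clique_cutN A x : clique A -> ~~ cut_vertex A x.
Proof.
move=> /forall_inP cA; apply/negP => /andP[_ /exists_inP[u /setD1P[ux uA]]].
case/exists_inP=> v /setD1P[vx vA] /andP[_ /negP[]].
have [->|uv] := eqVneq u v; first exact: connect0.
apply: linked_edge; rewrite ?inE ?ux ?vx //.
by have /forall_inP/(_ v vA)/implyP/(_ uv) := cA u uA.
Qed.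

Lemma rn_le f : radio_labeling f -> rn G <= Defs.span f.
Proof.
move=> rf; rewrite /rn; case: ex_minnP => n _; apply.
by apply/asboolP; exists f.
Qed.

Lemma rn_ge N : (forall f, radio_labeling f -> N <= Defs.span f) -> N <= rn G.
Proof.
move=> le; rewrite /rn; case: ex_minnP => n /asboolP[f rf <-] _; exact: le.
Qed.

Lemma span_ge f u v : f u - f v <= Defs.span f.
Proof.
apply: leq_trans (leq_bigmax u); apply: leq_trans (leq_bigmax v).
by lia.
Qed.

Lemma span_le f N : (forall u, f u <= N) -> Defs.span f <= N.
Proof.
move=> le; apply/bigmax_leqP => u _; apply/bigmax_leqP => v _.
by have := le u; have := le v; lia.
Qed.

End Generic.

(** * Radio numbers from orderings of the vertices *)

Section Bounds.

Variables (G : sgraph) (L : G -> nat) (T : nat).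

(** Listed by increasing label, consecutive vertices [u], [v] have labels at
    least [diam + 1 - dist u v >= T - L u - L v] apart.  In the sum of these
    bounds every level occurs twice, except at the two ends of the list, where
    the levels add up to at least [e]. *)
Lemma rn_lower_bound e :
    (forall u v, u != v -> T + dist u v <= (diam G).+1 + L u + L v) ->
    (forall u v, u != v -> e <= L u + L v) -> 1 < #|G| ->
  #|G|.-1 * T + e <= rn G + 2 * \sum_v L v.
Proof.
move=> dist_le end_ge G_gt1.
have rn_ge' N : (forall f : G -> nat, radio_labeling f ->
      N <= Defs.span f + 2 * \sum_v L v) ->
    N <= rn G + 2 * \sum_v L v.
  move=> le; suff: N - 2 * \sum_v L v <= rn G by lia.
  by apply: rn_ge => f rf; have := le f rf; lia.
apply: rn_ge' => f rf.
pose s := sort (relpre f leq) (enum G).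
have s_perm : perm_eq s (enum G) by rewrite perm_sort.
have s_uniq : uniq s by rewrite (perm_uniq s_perm) enum_uniq.
have s_size : size s = #|G| by rewrite (perm_size s_perm) -cardE.
have s_sorted : sorted (relpre f leq) s.
  by apply: sort_sorted => u v; exact: leq_total.
have s_sum : \sum_(v <- s) L v = \sum_v L v.
  by rewrite (perm_big _ s_perm) big_enum.
have telescope p : forall u, uniq (u :: p) -> path (relpre f leq) u p ->
    size p * T + L u + L (last u p) + f u
      <= f (last u p) + 2 * \sum_(v <- u :: p) L v.
  elim: p => [|w p IHp] u; first by rewrite big_seq1 /=; lia.
  rewrite /= inE negb_or => /andP[/andP[uw _] uq] /andP[/= fuw pP].
  have := IHp w uq pP; rewrite !big_cons /=.
  have := rf _ _ uw; have := dist_le _ _ uw.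
  by move: (last w p) (\sum_(v <- _) L v) => z S; lia.
case: s s_perm s_uniq s_size s_sorted s_sum => [|u [|w p]].
- by move=> _ _ /= G0; rewrite -G0 in G_gt1.
- by move=> _ _ /= G1; rewrite -G1 in G_gt1.
move=> _ uq <- /(telescope _ _ uq) + <-; rewrite [size (w :: p)]/=.
have ul : u != last w p.
  by apply: contraTneq uq => -> /=; rewrite mem_last.
have := end_ge _ _ ul; have := span_ge f (last w p) u; rewrite /=.
by move: (\sum_(v <- _) L v) => S; lia.
Qed.

Variables (l : nat -> nat) (x : 'I_#|G| -> G).
Hypotheses (x_inj : injective x) (L_x : forall i, L (x i) = l i).
Hypothesis (l_le : forall i, 2 * l i <= T).

(* The labels [F i] are determined by [F 0 = 0] and by the least gap allowed
   between consecutive vertices, [F i.+1 - F i = T - l i - l i.+1]. *)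
Let S i := \sum_(0 <= t < i) (T - 2 * l t).
Let F i := l 0 + S i - l i.

Let FE i : F i + l i = l 0 + S i.
Proof.
rewrite /F subnK //; elim: i => [|i IHi]; first exact: leq_addr.
by rewrite /S big_nat_recr //= -/(S i); have := (l_le i, l_le i.+1) => -[]; lia.
Qed.

Let F_diff i j : i < j ->
  F j + l i + l j = F i + T + \sum_(i.+1 <= t < j) (T - 2 * l t).
Proof.
move=> ij; have := FE j; have := FE i.
have -> : S j = S i + (T - 2 * l i) + \sum_(i.+1 <= t < j) (T - 2 * l t).
  rewrite /S (big_cat_nat (n := i)) //=; last exact: ltnW.
  by rewrite (big_ltn ij) addnA.
by have := l_le i; lia.
Qed.

(** The labels of positions [i < j] differ by
    [T - l i - l j + \sum_(i < t < j) (T - 2 * l t)], so that the hypothesis is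
    the radio condition.  The last label is the span; every level occurs twice
    in it, except at the two ends. *)
Lemma rn_upper_bound :
    (forall i j : 'I_#|G|, i < j -> (diam G).+1 + l i + l j <=
       T + dist (x i) (x j) + \sum_(i.+1 <= t < j) (T - 2 * l t)) ->
    0 < #|G| ->
  rn G + 2 * \sum_v L v <= #|G|.-1 * T + l 0 + l #|G|.-1.
Proof.
move=> x_far G_gt0.
have x_bij : bijective x by apply: inj_card_bij; rewrite ?card_ord.
have [g xK gK] := x_bij.
have F_le i j : i <= j -> F i <= F j.
  rewrite leq_eqVlt => /predU1P[->//|ij].
  have := F_diff ij; have := l_le i; have := l_le j.
  by move: (\sum_(_ <= t < _) _) => W; lia.
have far (i j : 'I_#|G|) : i < j -> (diam G).+1 - dist (x i) (x j) <= F j - F i.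
  move=> ij; have := x_far _ _ ij; have := F_diff ij.
  by move: (\sum_(_ <= t < _) _) => W; lia.
have rf : radio_labeling (fun v => F (g v)).
  move=> u v uv; rewrite -{1}[u]gK -{1}[v]gK.
  have : g u != g v by rewrite (inj_eq (can_inj gK)).
  rewrite -val_eqE neq_ltn => /orP[|] lt; first by have := far _ _ lt; lia.
  by rewrite dist_sym; have := far _ _ lt; lia.
have span_F : Defs.span (fun v => F (g v)) <= F #|G|.-1.
  by apply: span_le => v; apply: F_le; have := ltn_ord (g v); lia.
have := FE #|G|.-1.
have -> : \sum_v L v = \sum_(0 <= t < #|G|.-1.+1) l t.
  rewrite prednK // big_mkord (reindex x) /=; last exact: onW_bij.
  by apply: eq_bigr => i _; rewrite L_x.
have : S #|G|.-1 + 2 * \sum_(0 <= t < #|G|.-1) l t = #|G|.-1 * T.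
  rewrite /S big_distrr -big_split /= (eq_bigr (fun=> T)) => [|t _].
    by rewrite sum_nat_const_nat subn0.
  by rewrite subnK.
rewrite big_nat_recr //=; move: (\sum_(_ <= t < _) _) => W.
move: #|G|.-1 (leq_trans (rn_le rf) span_F) => q; lia.
Qed.

End Bounds.

(** * Graphs with addresses *)

Section Valid.

(* [K j] is the number of cliques joined to a vertex at step [j], and [N j] the
   number of new vertices of each of them.  The initial clique counts as step 0:
   it is the single clique joined to an imaginary root, whence [K 0 = 1] and
   [N 0 = m] below.  The parameter [h] bounds the length of the addresses. *)
Variables (K N : nat -> nat).
Implicit Types (a b x : address) (h j : nat).

Definition ok_entry j (e : nat * nat) := (e.1 < K j) && (e.2 < N j).

Definition valid h a :=
  [&& 0 < size a, size a <= h &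
      all (fun j => ok_entry j (nth (0, 0) a j)) (iota 0 (size a))].

Lemma validP h a :
  reflect [/\ 0 < size a, size a <= h &
             forall j, j < size a -> ok_entry j (nth (0, 0) a j)] (valid h a).
Proof.
apply: (iffP and3P) => -[a0 ah /= ok]; split=> //; first move=> j ja.
  by apply: (allP ok); rewrite mem_iota.
by apply/allP => j; rewrite mem_iota; apply: ok.
Qed.

Lemma valid_rcons h a e : valid h.+1 (rcons a e) =
  [&& (a == [::]) || valid h a, size a <= h & ok_entry (size a) e].
Proof.
rewrite /valid size_rcons !ltnS leq0n -[X in iota _ X]addn1 iotaD all_cat andTb.
rewrite /= add0n nth_rcons ltnn eqxx andbT.
under eq_in_all => j.
  by rewrite mem_iota nth_rcons => /andP[_ ->]; over.
by case: a => [|g a]; rewrite ?andbT //= andbCA; case: (_ <= h); rewrite ?andbF.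
Qed.

Lemma valid_prefix h a x : prefix x a -> x != [::] -> valid h a -> valid h x.
Proof.
case/prefixP => b -> x0 /validP[_ sz ok]; rewrite size_cat in sz ok.
apply/validP; split; [by rewrite lt0n size_eq0|lia|] => j jx.
by have := ok j; rewrite nth_cat jx; apply; lia.
Qed.

Lemma validW h a : valid h a -> valid h.+1 a.
Proof. by case/validP=> a0 ah ok; apply/validP; split=> //; exact: leqW. Qed.

Lemma validS h a : size a <= h -> valid h.+1 a -> valid h a.
Proof. by move=> ah /validP[a0 _ ok]; apply/validP; split. Qed.

Hypothesis K0 : K 0 = 1.

Lemma valid_head h a : valid h a -> a = (0, (head (0, 0) a).2) :: behead a.
Proof.
case/validP; case: a => [|[c i] a] //= _ _ /(_ 0 isT).
by rewrite /ok_entry K0 /= ltnS leqn0 => /andP[/eqP-> _].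
Qed.

Lemma valid_astep h a b :
  valid h a -> valid h b -> a != b -> valid h (astep a b).
Proof.
move=> va vb ab; have st0 : astep a b != [::].
  rewrite (valid_head va) (valid_head vb) /=.
  by case: (_ == _ :> nat * nat) => //; case: (behead a).
by case/orP: (astep_prefix a b) => p; apply: valid_prefix p st0 _.
Qed.

(** The vertices of [G] are in bijection with the valid addresses of length at
    most [h], adjacency being [adist = 1]; this determines [G]. *)
Record addressed (G : sgraph) (h : nat) (addr : G -> address) : Prop :=
  Addressed {
    addr_inj : injective addr;
    addr_valid : forall v, valid h (addr v);
    addr_onto : forall a, valid h a -> exists v, addr v = a;
    edge_addr : forall u v, edge u v = (adist (addr u) (addr v) == 1)
  }.

Variables (G : sgraph) (h : nat) (addr : G -> address).
Hypothesis H : addressed h addr.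
Implicit Types (u v w : G).

Lemma dist_addr u v : dist u v = adist (addr u) (addr v).
Proof.
pose t u v := adist (addr u) (addr v).
apply: (dist_eq (t := t)) => {}u => [|{}v w|{}v]; rewrite /t.
- exact: adistaa.
- rewrite (edge_addr H) => /eqP uv.
  by have := adist_triangle (addr v) (addr u) (addr w); rewrite uv.
rewrite -(inj_eq (addr_inj H)) => uv.
have [w Ew] := addr_onto H (valid_astep (addr_valid H u) (addr_valid H v) uv).
by exists w; rewrite ?(edge_addr H) Ew ?astep_edge // -astep_adist.
Qed.

Lemma size_addr v : 0 < size (addr v) <= h.
Proof. by have /validP[-> ->] := addr_valid H v. Qed.

Lemma addrE v : addr v = (0, (head (0, 0) (addr v)).2) :: behead (addr v).
Proof. exact: valid_head (addr_valid H v). Qed.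

Lemma ex_parent v : 1 < size (addr v) ->
  exists w e, addr v = rcons (addr w) e.
Proof.
move: (addr_valid H v); case/lastP E: (addr v) => [|a e] // va.
rewrite size_rcons ltnS lt0n size_eq0 => a0.
have [w <-] := addr_onto H (valid_prefix (prefix_rcons a e) a0 va).
by exists w, e.
Qed.

Lemma edge_parent v w e : addr v = rcons (addr w) e -> edge v w.
Proof.
by move=> vw; rewrite (edge_addr H) vw adist_rcons.
Qed.
End Valid.

(** * Cut-vertices and blocks *)

Section Addressed.

Variables (K N : nat -> nat).
Hypothesis K0 : K 0 = 1.
Variables (G : sgraph) (h : nat) (addr : G -> address).
Hypothesis H : addressed K N h addr.
Hypothesis h_gt0 : 0 < h.
Hypothesis KN_gt0 : forall j, j < h -> 0 < K j /\ 0 < N j.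
Implicit Types (u v w : G) (A B : {set G}).

Definition tops : {set G} := [set v | size (addr v) == 1].

Lemma ex_top i : i < N 0 -> exists2 v, v \in tops & addr v = [:: (0, i)].
Proof.
move=> iN; have vi : valid K N h [:: (0, i)].
  by apply/validP; split=> // -[|//] _; rewrite /ok_entry K0.
by have [v Ev] := addr_onto H vi; exists v; rewrite ?inE Ev.
Qed.

Lemma addr_top v : v \in tops -> exists2 i, i < N 0 & addr v = [:: (0, i)].
Proof.
rewrite inE => /eqP s1; have Ev := addrE K0 H v.
exists (head (0, 0) (addr v)).2.
  have /validP[_ _ /(_ 0)] := addr_valid H v; rewrite s1 nth0.
  by case/(_ isT)/andP.
by rewrite {1}Ev; congr (_ :: _); apply/size0nil; rewrite size_behead s1.
Qed.

Lemma tops_clique : clique tops.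
Proof.
apply/forall_inP => u /addr_top[i _ ui].
apply/forall_inP => v /addr_top[j _ vj].
rewrite -(inj_eq (addr_inj H)) (edge_addr H) ui vj; apply/implyP.
by rewrite eqseq_cons andbT /= => /negbTE->.
Qed.

(** From every vertex one climbs to the initial clique, whose vertices are
    pairwise adjacent. *)
Lemma linked_rooted A u v : tops \subset A ->
    (forall y z e, y \in A -> addr y = rcons (addr z) e -> z \in A) ->
  u \in A -> v \in A -> linked A u v.
Proof.
move=> /subsetP topA parA.
have rooted d : forall y, size (addr y) = d.+1 -> y \in A ->
    exists2 t, t \in tops & linked A y t.
  elim: d => [|d IHd] y sy yA.
    by exists y; [rewrite inE sy | exact: connect0].
  have [|z [e yz]] := ex_parent H (v := y); first by rewrite sy.
  have zA := parA _ _ _ yA yz; have sz : size (addr z) = d.+1.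
    by move: sy; rewrite yz size_rcons => -[].
  have [t tt zt] := IHd z sz zA; exists t => //.
  by apply: linked_trans zt; apply: linked_edge (edge_parent H yz).
have root y : y \in A -> exists2 t, t \in tops & linked A y t.
  have /andP[s0 _] := size_addr H y.
  by apply: (rooted (size (addr y)).-1); rewrite prednK.
move=> /root[t tt ut] /root[t' tt' vt']; apply: linked_trans ut _.
rewrite linked_sym in vt'; apply: linked_trans _ vt'.
have [->|neq] := eqVneq t t'; first exact: connect0.
apply: linked_edge; rewrite ?topA //.
have /forall_inP/(_ t tt)/forall_inP/(_ t' tt')/implyP := tops_clique.
exact.
Qed.

Lemma addressed_connected : connected_in [set: G].
Proof.
have [v _ _] := ex_top (KN_gt0 h_gt0).2.
rewrite /connected_in; apply/andP; split; first by apply/set0Pn; exists v.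
apply/forall_inP => u _; apply/forall_inP => w _.
by apply: linked_rooted; rewrite ?subsetT ?inE.
Qed.

(** A vertex of maximal level is the parent of none, so the climb to the initial
    clique never meets it. *)
Lemma leaf_end_vertex v : 1 < h -> size (addr v) = h -> end_vertex v.
Proof.
move=> h_gt1 vh; apply/negP => /andP[_ /exists_inP[u uv]].
case/exists_inP=> w wv /andP[_ /negP[]]; apply: linked_rooted => //.
  apply/subsetP => t; rewrite !inE andbT; apply: contraTneq => ->.
  by rewrite vh; lia.
move=> y z e _ yz; rewrite !inE andbT; apply: contraTneq (size_addr H y) => zv.
by rewrite yz zv size_rcons vh ltnn.
Qed.

Lemma branch_cut A z c u v :
    branch (addr z) c (addr u) -> ~~ branch (addr z) c (addr v) -> v != z ->
  u \in A -> v \in A -> linked A u v -> cut_vertex A z.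
Proof.
move=> bu bv vz uA vA.
apply: (separated_cut (C := fun y => branch (addr z) c (addr y))) => //.
  move=> y y' by_ yy' y'z; apply: contraT => nb.
  move: yy'; rewrite (edge_addr H) => /eqP yy'.
  by case/negP: y'z; apply/eqP/(addr_inj H)/(branch_sep by_ nb); rewrite yy'.
by apply: contraTneq bu => ->; apply/negP => /branch_size; rewrite ltnn.
Qed.

(** A child in the first clique joined to [v] is separated by [v] from the
    parent of [v] or, if [v] lies in the initial clique, from another vertex of
    this clique or from a child in the second clique joined to [v]. *)
Lemma inner_cut_vertex v : size (addr v) < h ->
  [|| 1 < size (addr v), 1 < N 0 | 1 < K 1] -> ~~ end_vertex v.
Proof.
move=> vh more; rewrite negbK.
have child c : c < K (size (addr v)) ->
    exists2 u, edge v u & addr u = rcons (addr v) (c, 0).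
  move=> cK; have [u Eu] : exists u, addr u = rcons (addr v) (c, 0).
    apply: (addr_onto H); rewrite -[h]prednK // valid_rcons.
    have h' : size (addr v) <= h.-1 by lia.
    rewrite h' /ok_entry cK (KN_gt0 vh).2 !andbT.
    apply/orP; right; apply: (validS h'); rewrite prednK //.
    exact: (addr_valid H).
  by exists u => //; rewrite edge_sym; exact: (edge_parent H Eu).
have [u vu Eu] := child 0 (KN_gt0 vh).1.
have [w vw nb] : exists2 w, edge v w & ~~ branch (addr v) 0 (addr w).
  have [v1|v1] := ltnP 1 (size (addr v)).
    have [w [e vw]] := ex_parent H v1.
    exists w; first exact: (edge_parent H vw).
    by apply/negP => /branch_size; rewrite vw size_rcons; lia.
  have vtop : v \in tops by have := size_addr H v; rewrite inE; lia.
  have [i iN Ev] := addr_top vtop.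
  case/or3P: more => [|N1|K1]; first by rewrite ltnNge v1.
    pose i' := if i == 0 then 1 else 0; have [|w _ Ew] := ex_top (i := i').
      by rewrite /i'; case: eqP; lia.
    have ii : i != i' by rewrite /i'; case: (i).
    exists w; rewrite ?(edge_addr H) Ev Ew /= !xpair_eqE (negbTE ii) //=.
  have s1 : size (addr v) = 1 by rewrite Ev.
  have [|w vw Ew] := child 1; first by rewrite s1.
  by exists w => //; rewrite Ew Ev /= eqxx.
have link y : edge v y -> linked setT v y by apply: linked_edge.
apply: (branch_cut (c := 0) (u := u) (v := w)) => //.
- by rewrite Eu (branch_rcons (addr v) (0, 0)).
- by apply: contraTneq vw => ->; rewrite edge_irr.
by apply: linked_trans (link _ vw); rewrite linked_sym; exact: link.
Qed.

(** Two distinct nonadjacent vertices of a connected set are separated by a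
    vertex that is then a cut-vertex of this set. *)
Lemma block_clique B : block B -> clique B.
Proof.
case/maxsetP=> /andP[/andP[_ /forall_inP cB] /forallP cutN] _.
apply/forall_inP => u uB; apply/forall_inP => v vB; apply/implyP => uv.
rewrite (edge_addr H) eqn_leq andbC lt0n adist_eq0 (inj_eq (addr_inj H)) uv /=.
rewrite leqNgt; apply/negP => lt1.
have luv : linked B u v by have /forall_inP := cB u uB; apply.
have [x [c [xp x0 sep]]] : exists x c,
    [/\ prefix x (addr u) || prefix x (addr v), x != [::] &
      separates x c (addr u) (addr v) || separates x c (addr v) (addr u)].
  by move: lt1; rewrite (addrE K0 H u) (addrE K0 H v); exact: separable_top.
have [z Ez] : exists z, addr z = x.
  apply: (addr_onto H).
  by case/orP: xp => p; apply: valid_prefix p x0 (addr_valid H _).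
case/negP: (cutN z); case/orP: sep => /and3P[bu bv xv].
  apply: (branch_cut (c := c) (u := u) (v := v)); rewrite ?Ez // eq_sym.
  by rewrite -(inj_eq (addr_inj H)) Ez.
apply: (branch_cut (c := c) (u := v) (v := u)); rewrite ?Ez //.
  by rewrite eq_sym -(inj_eq (addr_inj H)) Ez.
by rewrite linked_sym.
Qed.

Lemma addressed_block_graph : block_graph G.
Proof.
rewrite /block_graph addressed_connected; apply/forallP => B.
by apply/implyP; exact: block_clique.
Qed.

End Addressed.

(** * Weight centers *)

Definition swap (i i' t : nat) :=
  if t == i then i' else if t == i' then i else t.

Lemma swapK i i' : involutive (swap i i').
Proof.
move=> t; rewrite /swap; have [->|ti] := eqVneq t i.
  by rewrite eqxx; case: eqP.
by have [->|ti'] := eqVneq t i'; rewrite ?eqxx // (negbTE ti) (negbTE ti').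
Qed.

Lemma swap_lt i i' n t : i < n -> i' < n -> t < n -> swap i i' t < n.
Proof. by rewrite /swap; case: (t == i) => //; case: (t == i'). Qed.

Fixpoint map_at j (f : nat * nat -> nat * nat) (a : address) : address :=
  match j, a with
  | _, [::] => [::]
  | 0, e :: a' => f e :: a'
  | j'.+1, e :: a' => e :: map_at j' f a'
  end.

Lemma size_map_at j f a : size (map_at j f a) = size a.
Proof. by elim: j a => [|j IHj] [|e a] //=; rewrite IHj. Qed.

Lemma nth_map_at j f a i : i < size a ->
  nth (0, 0) (map_at j f a) i =
    if i == j then f (nth (0, 0) a i) else nth (0, 0) a i.
Proof. by elim: j a i => [|j IHj] [|e a] [|i] //= ia; rewrite IHj. Qed.

Lemma map_atK j f : involutive f -> involutive (map_at j f).
Proof. by move=> fK; elim: j => [|j IHj] [|e a] //=; rewrite ?fK ?IHj. Qed.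

Lemma valid_map_at K N h j f a :
    (forall e, ok_entry K N j e -> ok_entry K N j (f e)) ->
  valid K N h a -> valid K N h (map_at j f a).
Proof.
move=> fok /validP[a0 ah ok]; apply/validP; rewrite size_map_at.
split=> // i ia; rewrite nth_map_at //; case: eqP => [ij|_]; last exact: ok.
by rewrite -ij in fok *; apply/fok/ok.
Qed.

Lemma adist_map_head f a b :
    injective f -> (forall e g, ((f e).1 == (f g).1) = (e.1 == g.1)) ->
  adist (map_at 0 f a) (map_at 0 f b) = adist a b.
Proof.
by move=> f_inj f1; case: a b => [|e a] [|g b] //=; rewrite (inj_eq f_inj) f1.
Qed.

Section Centers.

Variables (K N : nat -> nat).
Hypothesis K0 : K 0 = 1.
Variables (G : sgraph) (h : nat) (addr : G -> address).
Hypothesis H : addressed K N h addr.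
Hypothesis h_gt0 : 0 < h.
Hypothesis KN_gt0 : forall j, j < h -> 0 < K j /\ 0 < N j.
Hypothesis N0_neq2 : N 0 != 2.
Hypothesis K1_ge2 : N 0 = 1 -> 1 < K 1.
Implicit Types (u v w y : G).

Let N0_gt0 : 0 < N 0. Proof. exact: (KN_gt0 h_gt0).2. Qed.

Local Notation tops := (tops addr).

Lemma ex_vertex_map (s : address -> address) :
    involutive s -> (forall a, valid K N h a -> valid K N h (s a)) ->
  exists2 sigma : G -> G,
    injective sigma & forall v, addr (sigma v) = s (addr v).
Proof.
move=> sK s_ok.
have /fin_all_exists[sigma Es] : forall v, exists u, addr u = s (addr v).
  by move=> v; apply: (addr_onto H); apply/s_ok/(addr_valid H).
exists sigma => // u v /(congr1 addr); rewrite !Es => /(can_inj sK).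
exact: (addr_inj H).
Qed.

(** For [y] outside the branch of [v], [dist v y = dist v t + dist t y], and for
    [y] inside at least [dist v y >= dist t y - dist v t].  As [sigma] moves
    the branch off itself, on the average of [y] and [sigma y] the second case
    is always made up for by the first. *)
Lemma wt_lt (sigma : G -> G) t v c :
    injective sigma -> (forall y, size (addr (sigma y)) = size (addr y)) ->
    branch (addr t) c (addr v) ->
    (forall y, branch (addr t) c (addr y) ->
       ~~ branch (addr t) c (addr (sigma y))) ->
  wt t < wt v.
Proof.
move=> s_inj s_size bv s_out.
have dbl u : 2 * wt u = \sum_y (dist u y + dist u (sigma y)).
  rewrite big_split mul2n -addnn /wt; under eq_bigr do rewrite dist_sym.
  by congr (_ + _); exact: (reindex_inj s_inj).
have far y : ~~ branch (addr t) c (addr y) -> dist v y = dist v t + dist t y.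
  by rewrite !(dist_addr K0 H); exact: adist_branch.
have near y : dist t y <= dist v t + dist v y.
  rewrite !(dist_addr K0 H) (adistC (addr v) (addr t)).
  exact: adist_triangle.
have vt : 0 < dist v t.
  rewrite (dist_addr K0 H) lt0n adist_eq0.
  by apply: contraTneq bv => ->; apply/negP => /branch_size; rewrite ltnn.
(* The inequality is strict at [t], which [sigma] keeps outside the branch. *)
rewrite -(ltn_pmul2l (m := 2)) // !dbl (bigD1 t) //= [ltnRHS](bigD1 t) //=.
rewrite -addSn; apply: leq_add; last first.
  apply: leq_sum => y _; have [by_|nby] := boolP (branch (addr t) c (addr y)).
    by have := near y; have := far _ (s_out y by_); lia.
  by have := far _ nby; have := near (sigma y); lia.
have nb y : size (addr y) = size (addr t) -> ~~ branch (addr t) c (addr y).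
  by move=> yt; apply/negP => /branch_size; rewrite yt ltnn.
by have := far t (nb t erefl); have := far _ (nb _ (s_size t)); lia.
Qed.

(** The branch of [v] at its central ancestor [t] is moved off itself by
    exchanging [t] with another vertex of the initial clique or, if there is
    none, the clique of the branch with another clique joined to [t]. *)
Lemma wt_top_lt v : v \notin tops -> exists2 t, t \in tops & wt t < wt v.
Proof.
have := addrE K0 H v; have /validP[v0 _ ok] := addr_valid H v.
rewrite inE neq_ltn ltnNge v0 /= => Ev v1.
have /andP[_ iN] := ok 0 v0; have /andP[cK _] := ok 1 v1.
rewrite nth0 in iN.
set i := (head _ _).2 in Ev iN; set c := (nth _ _ 1).1 in cK.
have [t tt Et] := ex_top K0 H h_gt0 iN; exists t => //.
have bv : branch (addr t) c (addr v).
  by rewrite Et /c Ev; move: v1; rewrite Ev /= eqxx; case: (behead _) => /=.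
have [N1|N1] := eqVneq (N 0) 1.
  pose c' := if c == 0 then 1 else 0.
  have c'c : c' != c by rewrite /c'; case: (c).
  have c'K : c' < K 1 by have := K1_ge2 N1; rewrite /c'; case: eqP; lia.
  pose f e : nat * nat := (swap c c' e.1, e.2).
  have fK : involutive f by case=> d e; rewrite /f /= swapK.
  have [|s s_inj Es] := ex_vertex_map (map_atK 1 fK).
    move=> a; apply: valid_map_at => e /andP[e1 e2].
    by rewrite /ok_entry swap_lt.
  apply: (wt_lt s_inj _ bv) => [y|y]; rewrite Es ?size_map_at // Et.
  case: (addr y) => //= e [|g a] /=; rewrite ?andbF // => /andP[-> /eqP->].
  by rewrite /swap eqxx.
pose i' := if i == 0 then 1 else 0.
have i'i : i' != i by rewrite /i'; case: (i).
have i'N : i' < N 0 by rewrite /i'; case: eqP; lia.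
pose f e : nat * nat := (e.1, swap i i' e.2).
have fK : involutive f by case=> d e; rewrite /f /= swapK.
have [|s s_inj Es] := ex_vertex_map (map_atK 0 fK).
  move=> a; apply: valid_map_at => e /andP[e1 e2].
  by rewrite /ok_entry swap_lt ?e1.
apply: (wt_lt s_inj _ bv) => [y|y]; rewrite Es ?size_map_at // Et.
case: (addr y) => //= e a /andP[/eqP<- _].
by rewrite /f /= /swap eqxx xpair_eqE /= eq_sym (negbTE i'i).
Qed.

Lemma wt_tops u v : u \in tops -> v \in tops -> wt u = wt v.
Proof.
case/(addr_top K0 H) => i iN Eu /(addr_top K0 H)[i' i'N Ev].
pose f e : nat * nat := (e.1, swap i i' e.2).
have fK : involutive f by case=> d e; rewrite /f /= swapK.
have [|s s_inj Es] := ex_vertex_map (map_atK 0 fK).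
  move=> a; apply: valid_map_at => e /andP[e1 e2].
  by rewrite /ok_entry swap_lt ?e1.
rewrite /wt [RHS](reindex_inj s_inj); apply: eq_bigr => y _.
rewrite !(dist_addr K0 H) Es -[LHS](adist_map_head _ _ (inv_inj fK)) //.
by rewrite Eu Ev /= /f /= /swap eqxx.
Qed.

Lemma weight_centersE : weight_centers G = tops.
Proof.
have [t tt _] := ex_top K0 H h_gt0 N0_gt0.
have wc_top v : v \in weight_centers G -> v \in tops.
  rewrite inE => /forallP min_v; apply: contraT => /wt_top_lt[w _].
  by rewrite ltnNge min_v.
apply/setP => v; apply/idP/idP; [exact: wc_top | move=> vt].
case: (arg_minnP (P := predT) (@wt G) (i0 := t)) => // u _ min_u.
have ut : u \in tops.
  by apply: wc_top; rewrite inE; apply/forallP => w; apply: min_u.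
by rewrite inE (wt_tops vt ut); apply/forallP => w; apply: min_u.
Qed.

Lemma epsE : eps G = (N 0 == 1).
Proof.
rewrite /eps weight_centersE; congr (nat_of_bool _).
have [t tt Et] := ex_top K0 H h_gt0 N0_gt0.
apply/cards1P/eqP => [[x tops1]|N1].
  apply/eqP; rewrite eqn_leq N0_gt0 andbT leqNgt; apply/negP => N1.
  have [w wt Ew] := ex_top K0 H h_gt0 N1.
  move: tt wt; rewrite tops1 !inE => /eqP tx /eqP wx.
  by move: Ew; rewrite wx -tx Et.
exists t; apply/setP => v; rewrite in_set1; apply/idP/eqP => [|-> //].
case/(addr_top K0 H)=> i; rewrite N1 ltnS leqn0 => /eqP-> Ev.
by apply: (addr_inj H); rewrite Ev Et.
Qed.

(** A vertex outside the initial clique is adjacent to at most one vertex of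
    it.  As the central block is a clique, it is therefore no larger than the
    initial clique. *)
Lemma central_verticesE : central_vertices G = tops.
Proof.
rewrite /central_vertices weight_centersE.
case: ifP => // tops_n1.
have N3 : 2 < N 0.
  by have := epsE; rewrite /eps weight_centersE tops_n1; case: eqP; lia.
have [t tt Et] := ex_top K0 H h_gt0 N0_gt0.
have [s st Es] := ex_top K0 H h_gt0 (ltnW N3).
rewrite /central_block weight_centersE; case: pickP => [B /andP[bB sB]|/=].
  apply/eqP; rewrite eqEsubset sB andbT; apply/subsetP => y yB.
  have /forall_inP/(_ y yB)/forall_inP cB := block_clique K0 H bB.
  apply: contraT => ny.
  have away w i : w \in tops -> addr w = [:: (0, i)] ->
      (head (0, 0) (addr y)).2 = i.
    move=> wt Ew; have := cB w (subsetP sB w wt); have /negbTE-> // : y != w.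
      by apply: contraNneq ny => ->.
    move: ny; rewrite inE (edge_addr H) Ew (addrE K0 H y) /=.
    rewrite xpair_eqE /= adists0; case: (eqVneq _ i) => // _.
    by case: (behead _) => // e a; rewrite !addn1.
  by have := away _ _ st Es; rewrite (away _ _ tt Et).
have := @maxset_exists _ (fun A : {set G} =>
  connected_in A && [forall x, ~~ cut_vertex A x]) tops.
case=> [|B maxB topB /(_ B)]; last by rewrite topB /block maxB.
have ct := tops_clique K0 H.
rewrite clique_connected //=; last by apply/set0Pn; exists t.
by apply/forallP => x; exact: clique_cutN.
Qed.

End Centers.

(** * Levels and diameter *)

Lemma bigminn_eq (I : finType) (A : {set I}) (F : I -> nat) d w :
    w \in A -> (forall i, i \in A -> F w <= F i) -> F w <= d ->
  \big[minn/d]_(i in A) F i = F w.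
Proof.
move=> wA wmin wd; apply/eqP; rewrite eqn_leq; apply/andP; split; last first.
  by apply: (big_ind (fun x => F w <= x)) => // x y wx wy; rewrite leq_min wx.
have: w \in index_enum I by exact: mem_index_enum.
elim: (index_enum I) => // i s IHs.
rewrite inE big_cons => /predU1P[<-|/IHs le].
  by rewrite wA geq_minl.
by case: ifP => // _; rewrite geq_min le orbT.
Qed.

Section Levels.

Variables (K N : nat -> nat).
Hypothesis K0 : K 0 = 1.
Variables (G : sgraph) (h : nat) (addr : G -> address).
Hypothesis H : addressed K N h addr.
Hypothesis h_gt1 : 1 < h.
Hypothesis KN_gt0 : forall j, j < h -> 0 < K j /\ 0 < N j.
Hypothesis N0_neq2 : N 0 != 2.
Hypothesis K1_ge2 : N 0 = 1 -> 1 < K 1.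
Implicit Types (u v w y : G).

Let h_gt0 : 0 < h. Proof. exact: ltnW. Qed.
Let eps_eq : eps G = (N 0 == 1). Proof. exact: (epsE K0 H). Qed.

Lemma levelE v : level v = (size (addr v)).-1.
Proof.
rewrite /level (central_verticesE K0 H) //.
have [_ _ /(_ 0)] := validP _ _ _ _ (addr_valid H v).
have /andP[v0 _] := size_addr H v; rewrite v0 nth0 => /(_ isT)/andP[_ iN].
have [t tt Et] := ex_top K0 H h_gt0 iN.
have dt : dist v t = (size (addr v)).-1.
  by rewrite (dist_addr K0 H) Et (addrE K0 H v) /= eqxx adists0.
rewrite -dt; apply: bigminn_eq => // [w wt|].
  rewrite dt (dist_addr K0 H) -subn1 leq_subLR.
  by have := leq_size_adist (addr v) (addr w); move: wt; rewrite inE => /eqP->.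
by rewrite /dist -[leqRHS](size_iota 0); exact: find_size.
Qed.

(** The path through the initial clique has one edge inside this clique, unless
    it is a single vertex. *)
Lemma dist_eps_lt u v : dist u v + eps G < size (addr u) + size (addr v).
Proof.
rewrite (dist_addr K0 H) eps_eq.
have /validP[u0 _ /(_ 0 u0)/andP[_]] := addr_valid H u.
have /validP[v0 _ /(_ 0 v0)/andP[_]] := addr_valid H v.
rewrite !nth0 (addrE K0 H u) (addrE K0 H v) /= xpair_eqE /=.
have := adist_leD (behead (addr u)) (behead (addr v)).
by case: (N 0 =P 1) => [->|_]; case: eqP => /=; lia.
Qed.

Lemma ex_zeros a : size a <= h ->
    (forall j, j < size a -> ok_entry K N j (nth (0, 0) a j)) ->
  exists v, addr v = a ++ nseq (h - size a) (0, 0).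
Proof.
move=> ah ok; apply: (addr_onto H); apply/validP.
rewrite size_cat size_nseq subnKC //.
split=> // j jh; rewrite nth_cat; case: ifP => [/ok//|_].
by rewrite nth_nseq if_same /ok_entry; apply/andP; apply: KN_gt0.
Qed.

(** The bound in [dist_eps_lt] is attained by two vertices of maximal level
    in different branches. *)
Lemma diamE : diam G + eps G = (2 * h).-1.
Proof.
apply/eqP; rewrite eqn_leq; apply/andP; split.
  have [v _ _] := ex_top K0 H h_gt0 (KN_gt0 h_gt0).2.
  have card0 : 0 < #|G| by apply/card_gt0P; exists v.
  have [u] := eq_bigmax (fun u : G => \max_v dist u v) card0.
  rewrite -/(diam G) => ->; have [w ->] := eq_bigmax (dist u) card0.
  have := dist_eps_lt u w; have := size_addr H u; have := size_addr H w; lia.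
have far u v : dist u v <= diam G.
  by apply: leq_trans (leq_bigmax u); apply: leq_trans (leq_bigmax v).
have [kn0 kn1] := (KN_gt0 h_gt0, KN_gt0 h_gt1).
have [N1|N1] := eqVneq (N 0) 1.
  have [|u Eu] := @ex_zeros [:: (0, 0); (0, 0)] h_gt1.
    by case=> [|[|j]] //= _; rewrite /ok_entry; apply/andP; apply: KN_gt0.
  have [|v Ev] := @ex_zeros [:: (0, 0); (1, 0)] h_gt1.
    case=> [|[|j]] //= _; first exact/andP.
    by rewrite /ok_entry K1_ge2 //; case: kn1.
  have := far u v; rewrite eps_eq N1 (dist_addr K0 H) Eu Ev /= !size_nseq.
  by lia.
have [|u Eu] := @ex_zeros [:: (0, 0)] h_gt0.
  by case=> [|j] //= _; rewrite /ok_entry; apply/andP; apply: KN_gt0.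
have [|v Ev] := @ex_zeros [:: (0, 1)] h_gt0.
  by case=> [|j] //= _; rewrite /ok_entry K0 /=; lia.
have := far u v; rewrite eps_eq (negbTE N1) (dist_addr K0 H) Eu Ev /=.
by rewrite !size_nseq; lia.
Qed.

End Levels.

(** * Addresses along the construction *)

Lemma adist_eq1_rconsr a b e : size a <= size b ->
  (adist a (rcons b e) == 1) = (a == b).
Proof.
elim: a b => [|g a IHa] [|l b] //=; first by rewrite size_rcons.
rewrite ltnS eqseq_cons => /IHa <-; case: (eqVneq g l) => // _.
by rewrite size_rcons !addnS.
Qed.

Lemma adist_eq1_rcons a b e g : size a = size b ->
  (adist (rcons a e) (rcons b g) == 1) = [&& a == b, e.1 == g.1 & e != g].
Proof.
elim: a b => [|l a IHa] [|l' b] //=.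
  by case: (eqVneq e g) => // _ _; case: (eqVneq e.1 g.1).
move=> [sab]; rewrite eqseq_cons; case: (eqVneq l l') => _; first exact: IHa.
by rewrite !size_rcons !addnS.
Qed.

Section Step.

Variables (K N : nat -> nat).
Hypothesis K0 : K 0 = 1.
Variables (G : sgraph) (h : nat) (addr : G -> address) (U : {set G}).
Hypothesis H : addressed K N h addr.
Hypothesis h_gt0 : 0 < h.
Hypothesis UE : U = [set v | size (addr v) == h].

Local Notation G' := (join_cliques U (K h) (N h)).

Definition join_addr (z : G') : address :=
  match z with
  | inl x => addr x
  | inr (s, c, i) => rcons (addr (val s)) (nat_of_ord c, nat_of_ord i)
  end.

Lemma size_joint (s : {s : G | s \in U}) : size (addr (val s)) = h.
Proof. by case: s => s /=; rewrite UE inE => /eqP. Qed.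

Lemma join_addressed : addressed K N h.+1 join_addr.
Proof.
have szx x : size (addr x) <= h by case/andP: (size_addr H x).
have inlr x s e : addr x <> rcons (addr (val (s : {s : G | s \in U}))) e.
  move/(congr1 size)=> E; have := szx x.
  by rewrite E size_rcons size_joint ltnn.
split.
- case=> [x|[[s c] i]] [y|[[t d] j]] /=.
  + by move/(addr_inj H) ->.
  + by move/inlr.
  + by move/esym/inlr.
  by case/rcons_inj=> /(addr_inj H)/val_inj-> /val_inj-> /val_inj->.
- case=> [x|[[s c] i]] /=; first exact/validW/addr_valid.
  rewrite valid_rcons (addr_valid H) orbT size_joint leqnn /ok_entry /=.
  by rewrite !ltn_ord.
- move=> a va; have [ah|ha] := leqP (size a) h.
    by have [x Ex] := addr_onto H (validS ah va); exists (inl x).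
  move: va ha; case/lastP: a => // a [c i]; rewrite valid_rcons size_rcons ltnS.
  case/and3P=> va ah /andP[cK iN] ha; have {ah ha} sa : size a = h by lia.
  case/orP: va => [/eqP a0|va].
    by have := h_gt0; rewrite -[X in 0 < X]sa a0.
  have [x Ex] := addr_onto H va.
  have xU : x \in U by rewrite UE inE Ex sa.
  rewrite [X in K X]sa in cK; rewrite [X in N X]sa in iN.
  by exists (inr (exist _ x xU, Ordinal cK, Ordinal iN)); rewrite /= Ex.
case=> [x|[[s c] i]] [y|[[t d] j]] /=.
- exact: (edge_addr H).
- rewrite adist_eq1_rconsr ?size_joint ?szx //.
  by rewrite (inj_eq (addr_inj H)).
- rewrite adistC adist_eq1_rconsr ?size_joint ?szx //.
  by rewrite (inj_eq (addr_inj H)).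
rewrite adist_eq1_rcons ?size_joint // (inj_eq (addr_inj H)) !xpair_eqE /=.
rewrite (inj_eq val_inj) !(inj_eq val_inj); case: (s == t) => //=.
by case: (c == d).
Qed.

Lemma card_join : #|G'| = #|G| + #|U| * (K h * N h).
Proof.
by rewrite card_sum !card_prod !card_ord card_sig mulnA.
Qed.

Lemma card_joined :
  #|[set z : G' | size (join_addr z) == h.+1]| = #|U| * (K h * N h).
Proof.
rewrite -sum1dep_card big_mkcond big_sumType /=.
rewrite big1 ?add0n => [|x _]; last first.
  by have /andP[_ xh] := size_addr H x; rewrite ltn_eqF.
rewrite (eq_bigr (fun=> 1)); last first.
  by case=> [[s c] i] _; rewrite size_rcons size_joint eqxx.
by rewrite sum1_card !card_prod !card_ord card_sig mulnA.
Qed.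

Lemma sum_join : \sum_z (size (join_addr z)).-1 =
  \sum_v (size (addr v)).-1 + h * (#|U| * (K h * N h)).
Proof.
rewrite big_sumType /=; congr (_ + _).
rewrite (eq_bigr (fun=> h)); last first.
  by case=> [[s c] i] _; rewrite size_rcons size_joint.
by rewrite sum_nat_const [LHS]mulnC !card_prod !card_ord card_sig -mulnA.
Qed.

Hypothesis KN_gt0 : forall j, j < h.+1 -> 0 < K j /\ 0 < N j.
Hypothesis N0_neq2 : N 0 != 2.
Hypothesis K1_ge2 : N 0 = 1 -> 1 < K 1.

(** The vertices to which cliques have just been joined are cut-vertices, and
    the new vertices have the maximal level. *)
Lemma joined_end_verticesE :
  joined_end_vertices U (K h) (N h) = [set z : G' | size (join_addr z) == h.+1].
Proof.
apply/setP => z; rewrite !inE.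
have endz := @leaf_end_vertex _ _ K0 _ _ _ join_addressed isT z.
have cutz := @inner_cut_vertex _ _ K0 _ _ _ join_addressed isT KN_gt0 z.
case: z endz cutz => [x|[[s c] i]] /=; last first.
  by rewrite size_rcons size_joint eqxx => ->.
have /andP[x0 xh] := size_addr H x; move=> _ cutx.
have -> : (x \in U) = (size (addr x) == h) by rewrite UE inE.
rewrite [RHS]ltn_eqF //; case: (eqVneq _ h) => //= Ex; apply/negbTE/cutx => //.
have [_ N0] := KN_gt0 (ltn0Sn h).
case: (eqVneq (N 0) 1) => [/K1_ge2->|N1]; first by rewrite !orbT.
by apply/or3P/Or32; lia.
Qed.

End Step.

(** For [0 < j], the number of vertices with addresses of length [j], and so the
    modulus that determines the first [j] digits of a position. *)
Definition radix (K N : nat -> nat) j := \prod_(i < j) (K i * N i).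

(** The parameters of the construction, with those of the initial clique put
    at index 0. *)
Definition level_seq (c : nat) (f : nat -> nat) j := if j is 0 then c else f j.

Lemma radixS K N j : radix K N j.+1 = radix K N j * (K j * N j).
Proof. by rewrite /radix big_ord_recr. Qed.

Section Construction.

Variables (m : nat) (k n : nat -> nat).
Let K := level_seq 1 k.
Let N := level_seq m n.
Let W := radix K N.

Lemma complete_addressed :
  addressed K N 1 (fun i : complete_graph m => [:: (0, val i)]).
Proof.
split=> [i j [/val_inj//]|i|a va|i j].
- by apply/validP; split=> // -[|//] _; rewrite /ok_entry /= ltn_ord.
- have /validP[a0 a1 /(_ 0 a0)/andP[_ iN]] := va.
  rewrite nth0 /= in iN.
  exists (Ordinal iN); rewrite /= [RHS](valid_head _ va) //.
  by congr (_ :: _); apply/esym/size0nil; rewrite size_behead; lia.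
rewrite /edge /= /complete_edge xpair_eqE /= (inj_eq val_inj).
by case: (eqVneq i j).
Qed.

Lemma lwr_addressed r :
    (forall j, j <= r -> 0 < K j /\ 0 < N j) -> m != 2 ->
    (m = 1 -> 0 < r -> 1 < K 1) ->
  exists addr : projT1 (lwr_steps m k n r) -> address,
  [/\ addressed K N r.+1 addr,
      projT2 (lwr_steps m k n r) = [set v | size (addr v) == r.+1],
      #|projT2 (lwr_steps m k n r)| = W r.+1,
      #|projT1 (lwr_steps m k n r)| = \sum_(j < r.+1) W j.+1 &
      \sum_v (size (addr v)).-1 = \sum_(j < r.+1) j * W j.+1].
Proof.
move=> KN_gt0 m2 K1; elim: r KN_gt0 K1 => [|r IHr] KN_gt0 K1.
  have W1 : W 1 = m by rewrite /W /radix big_ord1 mul1n.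
  exists (fun i => [:: (0, val i)]); rewrite !big_ord1 W1 mul0n /=; split.
  - exact: complete_addressed.
  - by apply/setP => v; rewrite !inE.
  - by rewrite cardsT card_ord.
  - exact: card_ord.
  - by rewrite big1.
have [j jr|m1 _|addr] := IHr; first by apply: KN_gt0; apply: leqW.
  exact: K1.
rewrite [in X in _ -> X]/=.
case: (lwr_steps m k n r) addr => G U addr /= [H UE cardU cardG levG].
exists (@join_addr K N G r.+1 addr U).
have jaddr := join_addressed (K := K) (N := N) erefl H isT UE.
have K1' : N 0 = 1 -> 1 < K 1 by move=> m1; apply: K1.
have jend :=
  joined_end_verticesE (K := K) (N := N) erefl H isT UE KN_gt0 m2 K1'.
split=> //.
- rewrite [LHS](congr1 (fun A : {set _} => #|A|) jend).
  by rewrite [LHS](card_joined (K := K) (N := N) H UE) cardU -radixS.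
- apply: etrans (card_join K N r.+1 U) _.
  by rewrite cardG cardU -radixS [RHS]big_ord_recr.
- apply: etrans (sum_join K N UE) _.
  by rewrite levG cardU -radixS [RHS]big_ord_recr.
Qed.

End Construction.

(** * The ordering by mixed-radix digits *)

Lemma eqn_modM s s' d q :
  s = s' %[mod d] -> s %/ d = s' %/ d %[mod q] -> s = s' %[mod d * q].
Proof.
move=> sd sq; rewrite mulnC (divn_eq (s %% _) d) [RHS](divn_eq _ d).
by rewrite -!modn_divl sq !(modn_dvdm _ (dvdn_mull q (dvdnn d))) sd.
Qed.

(** The integer [q] is the length of the longest common prefix. *)
Lemma adist_fork a b : exists q,
  [/\ q <= size a, q <= size b,
      forall t, t < q -> nth (0, 0) a t = nth (0, 0) b t &
      size a + size b <= adist a b + 2 * q \/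
      [/\ size a + size b <= adist a b + (2 * q).+1, q < size a, q < size b &
          (nth (0, 0) a q).1 = (nth (0, 0) b q).1]].
Proof.
elim: a b => [|e a IHa] [|g b];
  try by exists 0; split=> //; left; rewrite /= ?addn0.
have [<-|neq] := eqVneq e g.
  have [q [qa qb ab le]] := IHa b; exists q.+1; split=> //.
    by case=> [|t] //; exact: ab.
  rewrite /= eqxx; case: le => [le|[le ? ? eq]]; first by left; lia.
  by right; split=> //; lia.
exists 0; split=> //=; rewrite (negbTE neq).
case: (eqVneq e.1 g.1) => [eq|_] /=; last by left; lia.
by right; split=> //; lia.
Qed.

Section Digits.

Variables (K N : nat -> nat).
Local Notation W := (radix K N).

(** The [j]-th digit, a number below [K j * N j], is read as a pair with the
    clique number as its least significant part, so that consecutive positions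
    fall into different cliques at the central vertex when [m = 1]. *)
Definition digit s j : nat * nat :=
  let e := (s %/ W j) %% (K j * N j) in (e %% K j, e %/ K j).

Lemma digit_ok s j : 0 < K j -> 0 < N j -> ok_entry K N j (digit s j).
Proof.
move=> K_gt0 N_gt0; rewrite /ok_entry /digit /= ltn_pmod // ltn_divLR // mulnC.
by rewrite ltn_pmod // muln_gt0 K_gt0 N_gt0.
Qed.

Lemma valid_digits h l s : (forall j, j < h -> 0 < K j /\ 0 < N j) -> l < h ->
  valid K N h (mkseq (digit s) l.+1).
Proof.
move=> KN_gt0 lh; apply/validP; rewrite size_mkseq; split=> // j jl.
have [] := KN_gt0 j (leq_trans jl lh).
by rewrite nth_mkseq //; exact: digit_ok.
Qed.

Lemma digits_mod q s s' : (forall t, t < q -> digit s t = digit s' t) ->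
  s = s' %[mod W q].
Proof.
elim: q => [|q IHq] eq; first by rewrite /radix big_ord0 !modn1.
rewrite radixS; apply: eqn_modM; first by apply: IHq => t /ltnW; exact: eq.
have [e1 e2] := eq q (ltnSn q).
by rewrite (divn_eq (_ %% _) (K q)) e1 e2 -divn_eq.
Qed.

Lemma digits_mod_clique q s s' : (forall t, t < q -> digit s t = digit s' t) ->
  (digit s q).1 = (digit s' q).1 -> s = s' %[mod W q * K q].
Proof.
move=> /digits_mod eq; rewrite /digit /= !(modn_dvdm _ (dvdn_mulr _ (dvdnn _))).
exact: eqn_modM.
Qed.

Lemma mod_gap d s s' : s < s' -> s = s' %[mod d] -> d <= s' - s.
Proof.
move=> lt /esym/eqP; rewrite eqn_mod_dvd; last exact: ltnW.
by apply: dvdn_leq; rewrite subn_gt0.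
Qed.

Variable h : nat.
Hypothesis K0 : K 0 = 1.
Hypothesis K_gt0 : forall j, j < h -> 0 < K j.
Hypothesis N_ge2 : forall j, 0 < j < h -> 1 < N j.
Hypothesis N0_gt0 : 0 < N 0.
Hypothesis N0_neq2 : N 0 != 2.
Hypothesis K1_ge2 : N 0 = 1 -> 1 < K 1.

Lemma radix_double j : 0 < j < h -> 2 * W j <= W j.+1.
Proof.
move=> jh; rewrite radixS mulnC leq_mul // -[2]mul1n leq_mul ?N_ge2 ?K_gt0 //.
by case/andP: jh.
Qed.

Lemma radix1 : W 1 = N 0.
Proof. by rewrite /radix big_ord1 K0 mul1n. Qed.

Lemma radix_gt q : N 0 != 1 -> 0 < q <= h -> 2 * q < W q.
Proof.
move=> N1; elim: q => [|[|q] IHq] // qh; first by rewrite radix1; lia.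
by have := @radix_double q.+1 qh; have := IHq (ltnW qh); lia.
Qed.

Lemma radix_ge q : N 0 = 1 -> 1 < q <= h -> 2 * q <= W q.
Proof.
move=> N1; elim: q => [|[|[|q]] IHq] // qh.
  rewrite radixS radix1 N1 mul1n.
  by have := N_ge2 (j := 1) qh; have := K1_ge2 N1; nia.
by have := @radix_double q.+2 qh; have := IHq (ltnW qh); lia.
Qed.

Lemma digit_gap s s' q : s < s' -> q <= h ->
    (forall t, t < q -> digit s t = digit s' t) ->
  2 * q <= (N 0 == 1) + (s' - s).
Proof.
move=> lt qh /digits_mod/(mod_gap lt) gap; case: q qh gap => // q qh gap.
have [N1|N1] := eqVneq (N 0) 1; last by have := radix_gt N1 (q := q.+1) qh; lia.
case: q qh gap => [|q] qh gap; first by lia.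
by have := radix_ge N1 (q := q.+2) qh; lia.
Qed.

Lemma digit_gap_clique s s' q : s < s' -> q < h ->
    (forall t, t < q -> digit s t = digit s' t) ->
    (digit s q).1 = (digit s' q).1 ->
  2 * q < (N 0 == 1) + (s' - s).
Proof.
move=> lt qh eq eq1; have gap := mod_gap lt (digits_mod_clique eq eq1).
have {gap}[gap gapK] : W q <= s' - s /\ W q * K q <= s' - s.
  by split=> //; apply: leq_trans gap; apply: leq_pmulr; exact: K_gt0.
case: q qh {eq eq1} gap gapK => [|q] qh gap gapK; first by lia.
have [N1|N1] := eqVneq (N 0) 1; last first.
  by have := radix_gt N1 (q := q.+1) (ltnW qh); lia.
case: q qh gap gapK => [|q] qh gap gapK.
  by move: gapK; rewrite radix1 N1; have := K1_ge2 N1; lia.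
by have := radix_ge N1 (q := q.+2) (ltnW qh); lia.
Qed.

(** This implies the radio condition for the positions [s] and [s'].  A common
    prefix of length [q] makes the distance fall short of the total length of
    the addresses by [2 * q] or [2 * q + 1], and forces the positions apart by
    at least as much, up to [eps]: see [digit_gap] and [digit_gap_clique]. *)
Lemma digits_far s s' l l' : s < s' -> l < h -> l' < h ->
  l.+1 + l'.+1 <=
    (N 0 == 1) + adist (mkseq (digit s) l.+1) (mkseq (digit s') l'.+1)
    + (s' - s).
Proof.
move=> lt lh l'h; set a := mkseq _ _; set b := mkseq _ _.
have [sa sb] : size a = l.+1 /\ size b = l'.+1 by rewrite !size_mkseq.
have [q [qa qb ab le]] := adist_fork a b; rewrite sa sb in qa qb le.
have {}ab t : t < q -> digit s t = digit s' t.
  by move=> tq; have := ab t tq; rewrite !nth_mkseq //; lia.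
case: le => [le|[le qa' qb']].
  by have := digit_gap lt (leq_trans qa lh) ab; lia.
rewrite !nth_mkseq // => eq1.
by have := digit_gap_clique lt (leq_trans qa' lh) ab eq1; lia.
Qed.

End Digits.

Section Windows.

Variable W : nat -> nat.

Let cum l := \sum_(j < l) W j.

(** The position [j] in a list that consists of [W 0] entries, then [W 1]
    entries, and so on, belongs to the part numbered [window r j]. *)
Fixpoint window r j :=
  if r is r'.+1 then if cum r <= j then r else window r' j else 0.

Lemma windowP r j : j < cum r.+1 ->
  [/\ window r j <= r, cum (window r j) <= j & j < cum (window r j).+1].
Proof.
elim: r => [|r IHr] jr /=; first by rewrite /cum big_ord0.
case: (leqP (cum r.+1) j) => [le|lt]; first by split.
by have [le ? ?] := IHr lt; split=> //; exact: leqW.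
Qed.

Lemma window_eq r j l : l <= r -> cum l <= j < cum l.+1 -> window r j = l.
Proof.
have cum_le a b : a <= b -> cum a <= cum b.
  by move=> ab; rewrite /cum -(subnKC ab) big_split_ord leq_addr.
move=> lr /andP[lj jl]; have [|_ wj jw] := @windowP r j.
  exact: leq_trans jl (cum_le _ _ _).
have [lt|lt|//] := ltngtP (window r j) l.
  by have := cum_le _ _ lt; lia.
by have := cum_le _ _ lt; lia.
Qed.

End Windows.

(** * The radio number *)

Section RadioNumber.

Variables (K N : nat -> nat).
Hypothesis K0 : K 0 = 1.
Variables (G : sgraph) (h : nat) (addr : G -> address).
Hypothesis H : addressed K N h addr.
Hypothesis h_gt1 : 1 < h.
Hypothesis K_gt0 : forall j, j < h -> 0 < K j.
Hypothesis N_ge2 : forall j, 0 < j < h -> 1 < N j.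
Hypothesis N0_gt0 : 0 < N 0.
Hypothesis N0_neq2 : N 0 != 2.
Hypothesis K1_ge2 : N 0 = 1 -> 1 < K 1.

Local Notation W := (radix K N).
Let cum l := \sum_(j < l) W j.+1.
Hypothesis cardG : #|G| = cum h.

Let h_gt0 : 0 < h. Proof. exact: ltnW. Qed.
Let KN_gt0 j : j < h -> 0 < K j /\ 0 < N j.
Proof.
move=> jh; split; first exact: K_gt0.
by case: j jh => // j jh; apply/ltnW/N_ge2.
Qed.
Let card_gt1 : 1 < #|G|.
Proof.
rewrite cardG /cum -(subnKC h_gt1) big_split_ord /= big_ord_recr big_ord1 /=.
rewrite !radixS /radix big_ord0 K0 !mul1n; have := KN_gt0 h_gt1.
by have := N_ge2 (j := 1) h_gt1; nia.
Qed.

Let dE : diam G + eps G = (2 * h).-1. Proof. exact: (diamE K0 H). Qed.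
Let lE v : level v = (size (addr v)).-1. Proof. exact: (levelE K0 H). Qed.
Let eE : eps G = (N 0 == 1). Proof. exact: (epsE K0 H). Qed.

Let rn_ge_LB :
  #|G|.-1 * (2 * h).-1 + eps G <= rn G + 2 * \sum_(v : G) level v.
Proof.
have far u v : dist u v + eps G < size (addr u) + size (addr v).
  exact: (dist_eps_lt K0 H).
apply: rn_lower_bound => // u v uv; rewrite !lE.
  by have := far u v; have := size_addr H u; have := size_addr H v; lia.
have := far u v; have: 0 < dist u v; last by lia.
by rewrite (dist_addr K0 H) lt0n adist_eq0 (inj_eq (addr_inj H)).
Qed.

(* Levels increase along the positions, except that the list is rotated by one
   place.  This moves a central vertex to its end, and leaves at its beginning
   another one or, if there is none, a vertex of level one. *)
Let lev i := window (fun j => W j.+1) h.-1 (i.+1 %% #|G|).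

Let levP i : [/\ lev i < h, cum (lev i) <= i.+1 %% #|G| &
  i.+1 %% #|G| < cum (lev i).+1].
Proof.
have lt : i.+1 %% #|G| < cum h.-1.+1.
  by rewrite prednK // -cardG ltn_pmod // ltnW.
have [? ? ?] := @windowP (fun j => W j.+1) h.-1 _ lt.
by split; rewrite // -(prednK h_gt0).
Qed.

Let lev_last : lev #|G|.-1 = 0.
Proof.
rewrite /lev prednK ?(ltnW card_gt1) // modnn; apply: window_eq => //.
by rewrite big_ord0 big_ord1 (radix1 _ K0).
Qed.

Let lev_first : lev 0 = eps G.
Proof.
have W1 := @radix1 K N K0; rewrite eE /lev modn_small //; apply: window_eq.
  by case: (N 0 == 1) => //; lia.
have [N1|N1] := eqVneq (N 0) 1;
  rewrite ?big_ord0 ?big_ord_recr big_ord0 /= W1; last by lia.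
rewrite N1 add0n leqnn -addn1 leq_add2l radixS muln_gt0 W1 N0_gt0 muln_gt0.
by have [-> ->] := KN_gt0 h_gt1.
Qed.

Let code i := mkseq (digit K N i.+1) (lev i).+1.

(* The rotation only affects level 0, whose modulus [m] divides the order. *)
Let lev_mod i : i < #|G| -> i.+1 %% #|G| = i.+1 %[mod W (lev i).+1].
Proof.
rewrite leq_eqVlt => /predU1P[ip|/modn_small-> //].
have -> : lev i = 0 by rewrite -lev_last -ip.
rewrite ip modnn mod0n; apply/esym/eqP; rewrite -/(_ %| _) cardG.
apply: (big_ind (fun x => W 1 %| x)) => // [x y|j _]; first exact: dvdn_add.
by elim: (val j) => // l IHl; rewrite [W l.+2]radixS dvdn_mulr.
Qed.

(* Up to the rotation, the positions of level [l] form a window of [W l.+1]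
   consecutive integers, which are distinct modulo [W l.+1]. *)
Let code_inj i i' : i < #|G| -> i' < #|G| -> code i = code i' -> i = i'.
Proof.
move=> ip ip' E; have ll : lev i = lev i'.
  by move/(congr1 size): E; rewrite !size_mkseq => -[].
have eqd t : t < (lev i).+1 -> digit K N i.+1 t = digit K N i'.+1 t.
  move=> tl; move/(congr1 (fun a => nth (0, 0) a t)): E.
  by rewrite !nth_mkseq // -ll.
have := digits_mod eqd; rewrite -(lev_mod ip) {2}ll -(lev_mod ip') -ll => eqm.
have [_ l1 u1] := levP i; have [_ l2 u2] := levP i'; rewrite -ll in l2 u2.
have {eqm}jj : i.+1 %% #|G| = i'.+1 %% #|G|.
  move: l1 u1 l2 u2 eqm; rewrite /cum big_ord_recr /=.
  move: (_ %% _) (i'.+1 %% _) (W _) (\sum_(_ < _) _).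
  move=> j j' w c cj jc cj' j'c eqm.
  case: (ltngtP j j') => // [lt|lt].
    by have := mod_gap lt eqm; lia.
  by have := mod_gap lt (esym eqm); lia.
move/eqP: jj; rewrite -!(addn1 i) -(addn1 i') eqn_modDr !modn_small //.
by move/eqP.
Qed.

Let rn_le_LB :
  rn G + 2 * \sum_(v : G) level v <= #|G|.-1 * (2 * h).-1 + eps G.
Proof.
have /fin_all_exists[x xE] : forall i : 'I_#|G|, exists v, addr v = code i.
  by move=> i; apply: (addr_onto H); apply: valid_digits => //; case: (levP i).
have x_inj : injective x.
  move=> i j /(congr1 addr); rewrite !xE => eq.
  by apply/val_inj; apply: code_inj eq; exact: ltn_ord.
have -> : eps G = lev 0 + lev #|G|.-1 by rewrite lev_first lev_last addn0.
rewrite addnA.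
apply: (rn_upper_bound x_inj) => [i|i|i j ij|].
- by rewrite lE xE size_mkseq.
- by have [] := levP i; lia.
- rewrite (dist_addr K0 H) !xE.
  have := @digits_far K N h K0 K_gt0 N_ge2 N0_gt0 N0_neq2 K1_ge2 i.+1 j.+1
    (lev i) (lev j) ij.
  have [-> _ _] := levP i; have [-> _ _] := levP j.
  (* Each vertex between the two contributes at least one, as [lev t < h]. *)
  have : j - i.+1 <= \sum_(i.+1 <= t < j) ((2 * h).-1 - 2 * lev t).
    rewrite -[leqLHS]muln1 -sum_nat_const_nat; apply: leq_sum => t _.
    by have [] := levP t; lia.
  rewrite -eE -/(code i) -/(code j).
  by move: (\sum_(_ <= _ < _) _) (adist _ _) => S d; lia.
exact: ltnW.
Qed.

(** This is [rn = LB], freed from subtraction; [(2 * h).-1 = diam + eps] by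
    [diamE]. *)
Lemma rn_addressed :
  rn G + 2 * \sum_(v : G) level v = #|G|.-1 * (2 * h).-1 + eps G.
Proof.
by apply/eqP; rewrite eqn_leq rn_le_LB rn_ge_LB.
Qed.

End RadioNumber.

Import GRing.Theory Num.Theory.
Local Open Scope ring_scope.

Theorem theorem4p1 (r m : nat) (k n : nat -> nat)
    (r_gt0 : (0 < r)%N) (m_gt0 : (0 < m)%N) (m_neq2 : m <> 2%N)
    (k_gt0 : forall i, (1 <= i <= r)%N -> (0 < k i)%N)
    (n_ge2 : forall i, (1 <= i <= r)%N -> (2 <= n i)%N)
    (k1_ge2 : m = 1%N -> (2 <= k 1)%N) :
  let G := level_wise_regular m k n r in
  let P i := (\prod_(1 <= j < i.+1) (k j * n j))%N in
  lower_bound_block_graph G /\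
  (rn G)%:Z =
    ((m%:Z - 1) + m%:Z * \sum_(1 <= i < r.+1) (P i)%:Z) * (2 * r%:Z + 1)
    - 2 * m%:Z * \sum_(1 <= i < r.+1) i%:Z * (P i)%:Z
    + (eps G)%:Z.
Proof.
move=> G P; pose K := level_seq 1 k; pose N := level_seq m n.
have K_gt0 j : (j < r.+1)%N -> (0 < K j)%N by case: j => // j jr; apply: k_gt0.
have N_ge2 j : (0 < j < r.+1)%N -> (1 < N j)%N.
  by case: j => // j jr; apply: n_ge2.
have KN_gt0 j : (j < r.+1)%N -> (0 < K j)%N /\ (0 < N j)%N.
  by move=> jr; split; [exact: K_gt0 | case: j jr => // j jr; apply/ltnW/N_ge2].
have K0 : K 0 = 1%N by [].
have N0_neq2 : N 0 != 2 by apply/eqP.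
have K1_ge2 : N 0 = 1%N -> (1 < K 1)%N by [].
have [addr [H _ _ cardG levG]] :=
  lwr_addressed KN_gt0 N0_neq2 (fun m1 _ => k1_ge2 m1).
rewrite -/G in addr H cardG levG.
have W i : radix K N i.+1 = (m * P i)%N.
  elim: i => [|i IHi]; first by rewrite (radix1 _ K0) /P big_geq ?muln1.
  by rewrite radixS IHi /P [in RHS]big_nat_recr //= -mulnA.
have cardE : #|G| = (m + m * \sum_(1 <= i < r.+1) P i)%N.
  rewrite cardG -(big_mkord xpredT (fun j => radix K N j.+1)) big_ltn //.
  rewrite W {1}/P big_geq // muln1 big_distrr /=.
  by congr (_ + _)%N; apply: eq_bigr => i _; exact: W.
have levE : total_level G = (m * \sum_(1 <= i < r.+1) i * P i)%N.
  have -> : total_level G = \sum_v (size (addr v)).-1.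
    by apply: eq_bigr => v _; exact: (levelE K0 H r_gt0 KN_gt0 N0_neq2 K1_ge2).
  rewrite levG -(big_mkord xpredT (fun j => j * radix K N j.+1)%N) big_ltn //.
  by rewrite mul0n add0n big_distrr; apply: eq_bigr => i _; rewrite W mulnCA.
have rnE : (rn G + 2 * total_level G)%N = (#|G|.-1 * r.*2.+1 + eps G)%N.
  have -> : r.*2.+1 = (2 * r.+1).-1 by rewrite mul2n doubleS.
  exact: (rn_addressed K0 H r_gt0 K_gt0 N_ge2 m_gt0 N0_neq2 K1_ge2 cardG).
have dE : (diam G + eps G)%N = r.*2.+1.
  by rewrite (diamE K0 H r_gt0 KN_gt0 N0_neq2 K1_ge2) mul2n doubleS.
have G_gt0 : (0 < #|G|)%N by rewrite cardE addn_gt0 m_gt0.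
have -> : \sum_(1 <= i < r.+1) (P i)%:Z = (\sum_(1 <= i < r.+1) P i)%:Z.
  by rewrite (big_morph Posz PoszD (erefl _)).
have -> : \sum_(1 <= i < r.+1) i%:Z * (P i)%:Z =
          (\sum_(1 <= i < r.+1) i * P i)%:Z.
  by rewrite (big_morph Posz PoszD (erefl _)).
split; first (split; first exact: (addressed_block_graph K0 H)).
  by rewrite /LB; move: rnE dE G_gt0; nia.
move: rnE G_gt0; rewrite levE cardE.
move: (eps G) (rn G) (\sum_(_ <= _ < _) _)%N (\sum_(_ <= _ < _) _)%N => e q S T.
nia.
Qed.
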